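(* Let $(X_t)_{t>0}$ be a quadratic harness with $\mathbb{E}(X_t)=0$ and $\mathbb{E}(X_tX_s)=\min\{t,s\}$ for all $s,t>0$. Suppose that the quadratic harness condition $\mathbb{E}[X_t^2\mid\mathcal F_{s,u}]=Q_{t,s,u}(X_s,X_u)$ holds with $F_{t,s,u}\neq 0$ for all $0<s<t<u$, and that $1,X_s,X_t,X_sX_t,X_s^2,X_t^2$ are linearly independent (as random variables) for all $0<s<t$. Then there exist $\eta,\theta\in\mathbb{R}$, $\sigma,\tau\ge 0$ and $q\le 1+2\sqrt{\sigma\tau}$ such that for all $0<s<t<u$ $$\mathrm{Var}[X_t\mid\mathcal F_{s,u}]=F_{t,s,u}\Big(1+\eta\widetilde\Delta_{s,u}+\theta\Delta_{s,u}+\sigma\widetilde\Delta_{s,u}^2+\tau\Delta_{s,u}^2-(1-q)\Delta_{s,u}\widetilde\Delta_{s,u}\Big),$$ where $$F_{t,s,u}=\frac{(u-t)(t-s)}{u(1+\sigma s)+\tau-qs}.$$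
   Context: Equalities between conditional expectations hold almost surely. $(X_t)_{t>0}$ is a separable square-integrable real stochastic process. For $0<s<u$, $\mathcal F_{s,u}=\sigma\{X_t: t\in(0,s]\cup[u,\infty)\}$. For $0<t<u$ put $$\Delta_{t,u}=\frac{X_u-X_t}{u-t},\qquad \widetilde\Delta_{t,u}=\frac{uX_t-tX_u}{u-t}.$$ The process is a quadratic harness if for all $0<s<t<u$: (1) $\mathbb{E}[X_t\mid\mathcal F_{s,u}]=\frac{u-t}{u-s}X_s+\frac{t-s}{u-s}X_u$; and (2) $\mathbb{E}[X_t^2\mid\mathcal F_{s,u}]=Q_{t,s,u}(X_s,X_u)$, where $Q_{t,s,u}(x,y)=A_{t,s,u}x^2+B_{t,s,u}xy+C_{t,s,u}y^2+D_{t,s,u}x+E_{t,s,u}y+F_{t,s,u}$ is a quadratic form with deterministic real coefficients depending on $t,s,u$. The conditional variance is $\mathrm{Var}[X\mid\mathcal F]=\mathbb{E}[X^2\mid\mathcal F]-(\mathbb{E}[X\mid\mathcal F])^2$. *)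

(* Defs.v *)
From HB Require Import structures.
From mathcomp Require Import all_boot all_order all_algebra.
From mathcomp Require Import all_classical all_reals all_analysis.
From mathcomp Require Import measurable_realfun.

Set Implicit Arguments.
Unset Strict Implicit.
Unset Printing Implicit Defensive.

Import Order.TTheory GRing.Theory Num.Theory.
Import numFieldNormedType.Exports.

Local Open Scope classical_set_scope.
Local Open Scope ring_scope.

(* [G] is meant to be a sub-sigma-algebra of the ambient one, so that
   measurability from [g_sigma_algebraType G] is [G]-measurability. *)
Definition is_condexp (d : measure_display) (T : measurableType d)
    (R : realType) (P : probability T R) (G : set_system T)
    (Y Z : T -> R) : Prop :=
  [/\ measurable_fun [set: g_sigma_algebraType G] (Z : g_sigma_algebraType G -> R),
      P.-integrable [set: T] (EFin \o Z)
    & forall A, G A ->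
        (\int[P]_(w in A) (Z w)%:E = \int[P]_(w in A) (Y w)%:E)%E].

(* A chosen version of E[Y | G]; it exists for integrable [Y] ([condexpP]) and
   is a.s. unique ([condexp_ae_eq]), so the choice is immaterial in a.s.
   equalities. *)
Definition condexp (d : measure_display) (T : measurableType d)
    (R : realType) (P : probability T R) (G : set_system T)
    (Y : T -> R) : T -> R :=
  xget (cst 0) [set Z | is_condexp P G Y Z].

Definition condvar (d : measure_display) (T : measurableType d)
    (R : realType) (P : probability T R) (G : set_system T)
    (Y : T -> R) : T -> R :=
  fun w => condexp P G (fun w' => Y w' ^+ 2) w - condexp P G Y w ^+ 2.

Section condexp_facts.
Context (d : measure_display) (T : measurableType d) (R : realType).
Context (P : probability T R) (G : set_system T).
Context (sG : sigma_algebra [set: T] G)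
  (GT : G `<=` measurable).

Let GE : G.-sigma.-measurable = G.
Proof. exact: measurable_g_measurableTypeE. Qed.

Let T' : measurableType G.-sigma := g_sigma_algebraType G.

Let toG : T -> T' := fun x => x.

Let mtoG : measurable_fun [set: T] toG.
Proof. by move=> _ B; rewrite GE setTI => /GT. Qed.

Let fG : {mfun T >-> T'} :=
  HB.pack toG (isMeasurableFun.Build _ _ _ _ toG mtoG).

Let mu : probability (T') R := distribution P fG.

Lemma condexpP (Y : T -> R) : P.-integrable [set: T] (EFin \o Y) ->
  is_condexp P G Y (condexp P G Y).
Proof.
move=> iY; rewrite /condexp; case: xgetP => [//|noZ]; exfalso.
pose nu : {charge set (T') -> \bar R} :=
  measure_function_pushforward__canonical__charge_Charge (induced_charge iY) mtoG.
have numu : nu `<< mu.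
  apply/null_content_dominatesP => A; rewrite /= GE => /GT mA muA0.
  rewrite /nu /pushforward /induced_charge; apply: null_set_integral => //.
  exact: measurable_funS measurableT (@subsetT _ _) (measurable_int _ iY).
pose Z : T' -> \bar R := Radon_Nikodym nu mu.
have iZ : mu.-integrable [set: _] Z by exact: Radon_Nikodym_integrable.
have Zfin x : Z x \is a fin_num by exact: Radon_Nikodym_fin_num.
have ZE : EFin \o (fine \o Z) = Z by apply/funext => x /=; rewrite fineK.
have mZ := measurable_int _ iZ.
have PZ : P.-integrable [set: T] Z.
  apply/integrableP; split; first exact: (measurableT_comp mZ mtoG).
  move/integrableP : iZ => [_]; rewrite /mu ge0_integral_pushforward//.
  exact: measurableT_comp.
apply: (noZ (fine \o Z)); split.
- by apply/measurable_EFinP; rewrite ZE.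
- by rewrite ZE.
- move=> A GA; have mA : G.-sigma.-measurable A by rewrite GE.
  transitivity (\int[mu]_(x in A) Z x)%E.
    rewrite /mu integral_pushforward//.
      by apply: eq_integral => x _ /=; rewrite fineK.
    by apply: (integrableS measurableT) => //; exact: GT.
  by rewrite -Radon_Nikodym_integral.
Qed.

Lemma condexp_ae_eq (Y Z : T -> R) : is_condexp P G Y Z ->
  {ae P, forall w, condexp P G Y w = Z w}.
Proof.
move=> cZ; rewrite /condexp; case: xgetP => [Z' _|/(_ _ cZ)//].
case=> mZ' iZ' Z'E; case: cZ => mZ iZ ZE.
have m_mu (V : T' -> R) : measurable_fun [set: T'] V ->
    measurable_fun [set: T'] (EFin \o V : T' -> \bar R).
  by move=> mV; exact/measurable_EFinP.
have i_mu (V : T' -> R) : measurable_fun [set: T'] V ->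
    P.-integrable [set: T] (EFin \o V) -> mu.-integrable [set: _] (EFin \o V).
  by move=> mV iV; apply: integrable_pushforward => //; exact: m_mu.
have [N [mN N0 sub]] : ae_eq mu [set: _] (EFin \o Z') (EFin \o Z).
  apply: integral_ae_eq => //; [exact: i_mu|exact: m_mu|move=> A _ mA].
  have GA : G A by rewrite -GE.
  rewrite /mu !integral_pushforward//.
  - by rewrite [LHS](Z'E A GA) [RHS](ZE A GA).
  - exact: m_mu.
  - by apply: (integrableS measurableT) => //; exact: GT.
  - exact: m_mu.
  - by apply: (integrableS measurableT) => //; exact: GT.
exists N; split => //; first by apply: GT; rewrite -GE.
by move=> w /= H; apply: sub => /= H'; apply: H; exact: EFin_inj (H' I).
Qed.

End condexp_facts.

(* Processes indexed by (0, oo) are total families [X : R -> {RV P >-> R}] of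
   which only the values at positive times are ever used. *)

(* Separability in the sense of Doob. *)
Definition separable_process (d : measure_display) (T : measurableType d)
    (R : realType) (P : probability T R) (X : R -> {RV P >-> R}) : Prop :=
  exists (D : set R) (N : set T),
    [/\ countable D, D `<=` `]0, +oo[, `]0, +oo[ `<=` closure D,
        P.-negligible N
      & forall O K : set R, open O -> O `<=` `]0, +oo[ -> closed K ->
          [set w | forall t, (O `&` D) t -> K (X t w)] `\`
          [set w | forall t, O t -> K (X t w)] `<=` N].

Definition past_future (d : measure_display) (T : measurableType d)
    (R : realType) (P : probability T R) (X : R -> {RV P >-> R})
    (s u : R) : set_system T :=
  <<s \bigcup_(t in `]0, s] `|` `[u, +oo[)
        preimage_set_system [set: T] (X t) measurable >>.

Section past_future_facts.
Context (d : measure_display) (T : measurableType d) (R : realType).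
Context (P : probability T R) (X : R -> {RV P >-> R}).

Lemma past_future_sigma_algebra s u :
  sigma_algebra [set: T] (past_future X s u).
Proof. exact: smallest_sigma_algebra. Qed.

Lemma past_future_measurable s u : past_future X s u `<=` measurable.
Proof.
apply: smallest_sub; first exact: sigma_algebra_measurable.
by move=> A [t _ [B mB <-]]; exact: measurable_funP.
Qed.

End past_future_facts.

Definition quadratic_harness (d : measure_display) (T : measurableType d)
    (R : realType) (P : probability T R) (X : R -> {RV P >-> R})
    (A B C D E F : R -> R -> R -> R) : Prop :=
  forall s t u : R, 0 < s -> s < t -> t < u ->
    {ae P, forall w, condexp P (past_future X s u) (X t) w =
       (u - t) / (u - s) * X s w + (t - s) / (u - s) * X u w} /\
    {ae P, forall w,
       condexp P (past_future X s u) (fun w' => X t w' ^+ 2) w =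
       A t s u * X s w ^+ 2 + B t s u * (X s w * X u w)
       + C t s u * X u w ^+ 2 + D t s u * X s w + E t s u * X u w + F t s u}.

Definition Delta (d : measure_display) (T : measurableType d)
    (R : realType) (P : probability T R) (X : R -> {RV P >-> R})
    (t u : R) : T -> R :=
  fun w => (X u w - X t w) / (u - t).

Definition tDelta (d : measure_display) (T : measurableType d)
    (R : realType) (P : probability T R) (X : R -> {RV P >-> R})
    (t u : R) : T -> R :=
  fun w => (u * X t w - t * X u w) / (u - t).

(* Linear independence of random variables up to a.s. equality. *)
Definition ae_lin_indep (d : measure_display) (T : measurableType d)
    (R : realType) (P : probability T R) (n : nat)
    (f : n.-tuple (T -> R)) : Prop :=
  forall c : 'I_n -> R,
    {ae P, forall w, \sum_(i < n) c i * tnth f i w = 0} -> forall i, c i = 0.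

(* Main.v *)
Require Import Defs.
From HB Require Import structures.
From mathcomp Require Import all_boot all_order all_algebra.
From mathcomp Require Import all_classical all_reals all_analysis.
From mathcomp Require Import measurable_realfun.
From mathcomp Require Import ring lra.

(* Let [s < t < r < u]. Computing [E[X_t X_r | F_{s,u}]] once through [F_{t,u}]
   and once through [F_{s,r}] shows that [Var[X_t | F_{s,u}] / ((u-t)(t-s))]
   does not depend on [t]. Computing [E[X_t^2 | F_{s,u}]] through [F_{s,r}] and
   [E[X_r^2 | F_{s,u}]] through [F_{t,u}] yields affine relations between the
   conditional variances at [(s,u)] and at [(s,r)], resp. [(t,u)]; they are
   coefficientwise because the interpolation [X_r -> E[X_r | F_{s,u}]] carries
   [Delta_{s,r}, tDelta_{s,r}] to [Delta_{s,u}, tDelta_{s,u}]. Linear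
   independence turns all of this into identities between coefficients, which
   force [Var[X_t | F_{s,u}] / F_{t,s,u}], as a polynomial in [tDelta, Delta], to
   be independent of [s, t, u]. Taking expectations then computes [F], and the
   inequalities on [sigma, tau, q] come from the denominator never vanishing. *)

Import Order.TTheory GRing.Theory Num.Theory.
Import numFieldNormedType.Exports.

Set Implicit Arguments.
Unset Strict Implicit.
Unset Printing Implicit Defensive.

Local Open Scope classical_set_scope.
Local Open Scope ring_scope.

(** * Calculus of conditional expectations *)

Section condexp_calculus.
Context (d : measure_display) (T : measurableType d) (R : realType).
Context (P : probability T R) (G : set_system T).
Context (sG : sigma_algebra [set: T] G) (GT : G `<=` measurable).

Notation integrable Y := (P.-integrable [set: T] (EFin \o Y)).
Notation T' := (g_sigma_algebraType G).
Notation measurableG Z := (measurable_fun [set: T'] (Z : T' -> R)).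

Lemma measurable_sub_sigma_algebra (B : set T) :
  measurable (B : set T') -> G B.
Proof.
suff -> : (measurable : set_system T') = G by [].
exact: measurable_g_measurableTypeE.
Qed.

Lemma measurable_fun_sub_sigma_algebra (Z : T -> R) :
  measurableG Z -> measurable_fun [set: T] Z.
Proof.
move=> mZ _ B mB; apply: GT; apply: measurable_sub_sigma_algebra.
exact: mZ.
Qed.

Import HBNNSimple.

(** [Z] is the increasing limit of [G]-measurable simple functions [Zn]. Each level set of [Zn] lies
    in [G], so [Zn * h] has integral zero over [A]; since [0 <= Zn <= Z], dominated convergence with
    bound [|Z * h|] passes to the limit. *)
Lemma integral_mul_ge0_eq0 (h Z : T -> R) : integrable h ->
  (forall A, G A -> (\int[P]_(w in A) (h w)%:E = 0)%E) ->
  measurableG Z -> (forall w, 0 <= Z w) -> integrable (Z \* h) ->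
  forall A, G A -> (\int[P]_(w in A) (Z w * h w)%:E = 0)%E.
Proof.
move=> ih h0 mZ Z0 iZh A GA.
have mA := GT GA.
have mZE : measurable_fun [set: T'] (EFin \o Z : T' -> \bar R).
  exact/measurable_EFinP.
pose Zn := nnsfun_approx (@measurableT _ T') mZE.
have Z0E (x : T') : [set: T'] x -> (0 <= (EFin \o Z) x)%E.
  by rewrite /= lee_fin.
have ndZn := nd_nnsfun_approx (@measurableT _ T') mZE.
have cvZn (x : T') : EFin \o Zn ^~ x @ \oo --> (EFin \o Z) x.
  exact: (cvg_nnsfun_approx measurableT mZE Z0E).
have cvZnR (x : T') : Zn ^~ x @ \oo --> Z x.
  by move/fine_cvgP : (cvZn x) => [].
have ZnZ n x : Zn n x <= Z x.
  have nd : nondecreasing_seq (Zn ^~ x).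
    by move=> k m km; exact: (lefP _ _ (ndZn _ _ km) x).
  rewrite -(cvg_lim _ (cvZnR x))//.
  by apply: nondecreasing_cvgn_le => //; apply/cvg_ex; exists (Z x).
have mZn n : measurable_fun [set: T] (Zn n : T -> R).
  by apply: measurable_fun_sub_sigma_algebra; exact: measurable_funP.
have mh : measurable_fun [set: T] h.
  exact/measurable_EFinP/(measurable_int P).
have patchM (B : set T) :
    (fun w => (\1_B w * h w)%:E) = (EFin \o h) \_ B.
  apply/funext => w; rewrite patchE indicE.
  by case: ifP; rewrite ?mul1r ?mul0r.
(* The contribution of one level set [B] is [c] times the integral of [h] over the intersection of
   [A] and [B], which is again in [G]. *)
have hc c (B : set T) : G B ->
    P.-integrable A (fun w => (c * \1_B w * h w)%:E) /\
    (\int[P]_(w in A) (c * \1_B w * h w)%:E = 0)%E.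
  move=> GB; have mB := GT GB.
  have iB : P.-integrable A (fun w => (\1_B w * h w)%:E).
    rewrite patchM; apply: (integrableS measurableT) => //.
    apply: (iffLR (integrable_mkcond _ mB)).
    exact: (integrableS measurableT mB (@subsetT _ _) ih).
  under eq_fun do rewrite -mulrA EFinM.
  split; first exact: integrableZl.
  rewrite integralZl// patchM -integral_mkcondr h0 ?mule0//.
  apply: measurable_sub_sigma_algebra; apply: measurableI.
    exact: sub_sigma_algebra.
  exact: sub_sigma_algebra.
have Zn0 n : (\int[P]_(w in A) (Zn n w * h w)%:E = 0)%E.
  under eq_integral => w _.
    rewrite fimfunEord mulr_suml -sumEFin.
    over.
  have GZn (c : R) : G (Zn n @^-1` [set c]).
    by apply: measurable_sub_sigma_algebra; exact: measurable_funPTI.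
  rewrite integral_sum//= ?big1// => [i _|i].
    exact: (hc _ _ (GZn _)).2.
  exact: (hc _ _ (GZn _)).1.
have iZhA := integrableS measurableT mA (@subsetT _ _) iZh.
have [|||||_ _ +] := @dominated_convergence _ T R P A mA
    (fun n w => (Zn n w * h w)%:E) (fun w => (Z w * h w)%:E)
    (fun w => `|(Z w * h w)%:E|%E).
- move=> n; apply/measurable_EFinP.
  apply: (@measurable_funS _ _ _ _ [set: T]) => //.
  exact: measurable_funM.
- exact: measurable_int iZhA.
- apply/aeW => w _; apply: cvg_EFin; first exact: nearW.
  by apply: cvgMl; exact: cvZnR.
- exact: integrable_abse.
- apply/aeW => w n _; rewrite !abse_EFin lee_fin !normrM ler_wpM2r//.
  by rewrite !ger0_norm//; exact: fun_ge0.
- rewrite (_ : (fun n => _) = cst 0%E).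
    by move/(cvg_unique _ (cvg_cst _)) => /(_ (@ereal_hausdorff R)) <-.
  by apply/funext => n; exact: Zn0.
Qed.

(** Split [Z] into positive and negative parts; both products with [h] are dominated by [|Z * h|],
    hence integrable. *)
Lemma integral_mul_eq0 (h Z : T -> R) : integrable h ->
  (forall A, G A -> (\int[P]_(w in A) (h w)%:E = 0)%E) ->
  measurableG Z -> integrable (Z \* h) ->
  forall A, G A -> (\int[P]_(w in A) (Z w * h w)%:E = 0)%E.
Proof.
move=> ih h0 mZ iZh A GA; have mA := GT GA.
have mZT := measurable_fun_sub_sigma_algebra mZ.
have mh : measurable_fun [set: T] h.
  exact/measurable_EFinP/(measurable_int P).
have ipos : integrable (Z^\+ \* h).
  apply: le_integrable iZh => //.
    apply/measurable_EFinP/measurable_funM => //.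
    exact: measurable_funrpos.
  move=> w _ /=; rewrite lee_fin !normrM ler_wpM2r//.
  rewrite /funrpos ger0_norm ?le_max ?lexx ?orbT//.
  by rewrite ge_max ler_norm normr_ge0.
have ineg : integrable (Z^\- \* h).
  apply: le_integrable iZh => //.
    apply/measurable_EFinP/measurable_funM => //.
    exact: measurable_funrneg.
  move=> w _ /=; rewrite lee_fin !normrM ler_wpM2r//.
  rewrite /funrneg ger0_norm ?le_max ?lexx ?orbT//.
  by rewrite ge_max -normrN ler_norm normr_ge0.
have -> : (\int[P]_(w in A) (Z w * h w)%:E =
    \int[P]_(w in A) ((Z^\+ w * h w)%:E - (Z^\- w * h w)%:E))%E.
  apply: eq_integral => w _.
  by rewrite -EFinB -mulrBl -[Z in LHS]funrposBneg.
rewrite integralB//=; [|exact: integrableS ipos|exact: integrableS ineg].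
have -> : (\int[P]_(w in A) (Z^\+ w * h w)%:E = 0)%E.
  apply: (integral_mul_ge0_eq0 ih h0 _ _ ipos GA) => [|w].
    exact: measurable_funrpos.
  exact: funrpos_ge0.
have -> : (\int[P]_(w in A) (Z^\- w * h w)%:E = 0)%E.
  apply: (integral_mul_ge0_eq0 ih h0 _ _ ineg GA) => [|w].
    exact: measurable_funrneg.
  exact: funrneg_ge0.
by rewrite sube0.
Qed.

(** Working with arbitrary versions [Z] rather than the chosen [condexp] keeps sums, products and
    towers free of null sets. Integrability of [Y] is bundled because [is_condexp] only asks it of
    [Z]. *)
Definition has_condexp (Y Z : T -> R) := integrable Y /\ is_condexp P G Y Z.

Lemma has_condexp_measurable (Z : T -> R) :
  measurableG Z -> integrable Z -> has_condexp Z Z.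
Proof. by []. Qed.

Lemma has_condexpD (Y1 Y2 Z1 Z2 : T -> R) :
  has_condexp Y1 Z1 -> has_condexp Y2 Z2 ->
  has_condexp (fun w => Y1 w + Y2 w) (fun w => Z1 w + Z2 w).
Proof.
move=> [iY1 [mZ1 iZ1 E1]] [iY2 [mZ2 iZ2 E2]].
split; first exact: (integrableD measurableT iY1 iY2).
split; [exact: measurable_funD|exact: (integrableD measurableT iZ1 iZ2)|].
move=> A GA; have mA := GT GA.
by rewrite !integralD_EFin ?E1 ?E2//; exact: (integrableS measurableT).
Qed.

Lemma has_condexpZ (c : R) (Y Z : T -> R) :
  has_condexp Y Z -> has_condexp (fun w => c * Y w) (fun w => c * Z w).
Proof.
move=> [iY [mZ iZ E1]].
split; first exact: (integrableZl measurableT c iY).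
split; [exact: measurable_funM|exact: (integrableZl measurableT c iZ)|].
move=> A GA; have mA := GT GA.
under eq_integral do rewrite EFinM.
under [RHS]eq_integral do rewrite EFinM.
by rewrite !integralZl ?E1//; exact: (integrableS measurableT).
Qed.

(** Pulling out a known factor: [Y - Y'] integrates to zero over every set of [G], and
    [integral_mul_eq0] keeps this true after multiplication by [Z]. *)
Lemma has_condexpM (Y Y' Z : T -> R) : measurableG Z ->
  integrable (fun w => Z w * Y w) -> integrable (fun w => Z w * Y' w) ->
  has_condexp Y Y' ->
  has_condexp (fun w => Z w * Y w) (fun w => Z w * Y' w).
Proof.
move=> mZ iZY iZY' [iY [mY' iY' E1]].
split => //; split => //; first exact: measurable_funM.
move=> A GA; have mA := GT GA.
have ih : integrable (Y \- Y') by exact: (integrableB measurableT iY iY').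
have iZh : integrable (Z \* (Y \- Y')).
  apply: eq_integrable (integrableB measurableT iZY iZY') => // w _ /=.
  by rewrite -EFinB -mulrBr.
have h0 B : G B -> (\int[P]_(w in B) ((Y \- Y') w)%:E = 0)%E.
  move=> GB; have mB := GT GB.
  have iYB := integrableS measurableT mB (@subsetT _ _) iY.
  have iYB' := integrableS measurableT mB (@subsetT _ _) iY'.
  have := integralB_EFin mB iYB iYB'; rewrite /= => ->.
  by rewrite E1// subee//; exact: integrable_fin_num iYB.
have iZA := integrableS measurableT mA (@subsetT _ _) iZY'.
have iZhA := integrableS measurableT mA (@subsetT _ _) iZh.
have := integralD_EFin mA iZA iZhA.
rewrite /= (integral_mul_eq0 ih h0 mZ iZh GA) adde0 => <-.
by apply: eq_integral => w _; congr EFin; rewrite /=; ring.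
Qed.

Lemma has_condexp_unique (Y Z1 Z2 : T -> R) :
  has_condexp Y Z1 -> has_condexp Y Z2 -> {ae P, forall w, Z1 w = Z2 w}.
Proof.
move=> [_ /(condexp_ae_eq sG GT) e1] [_ /(condexp_ae_eq sG GT) e2].
by move: e1 e2; apply: filterS2 => w <- <-.
Qed.

(** Turns the harness conditions, stated almost surely for [condexp], into explicit versions. Almost
    sure equality does not transport [G]-measurability, so that of [Z] is assumed. *)
Lemma has_condexp_ae (Y Z : T -> R) : integrable Y -> integrable Z ->
  measurableG Z -> {ae P, forall w, condexp P G Y w = Z w} -> has_condexp Y Z.
Proof.
move=> iY iZ mZ eZ; have [mC iC CE] := condexpP sG GT iY.
split=> //; split => // A GA; have mA := GT GA.
rewrite -CE//; apply: ae_eq_integral => //.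
- exact: (measurable_int P (integrableS measurableT mA (@subsetT _ _) iZ)).
- exact: (measurable_int P (integrableS measurableT mA (@subsetT _ _) iC)).
- by apply: filterS eZ => w /= ->.
Qed.

Lemma has_condexp_expectation (Y Z : T -> R) :
  has_condexp Y Z -> (\int[P]_w (Y w)%:E = \int[P]_w (Z w)%:E)%E.
Proof.
case: (sG) => G0 GC _ [_ [_ _ ->]]//.
by rewrite -(setD0 [set: T]); exact: GC.
Qed.

End condexp_calculus.

Lemma has_condexp_tower (d : measure_display) (T : measurableType d)
    (R : realType) (P : probability T R) (G H : set_system T)
    (Y Z W : T -> R) : G `<=` H ->
  has_condexp P H Y Z -> has_condexp P G Z W -> has_condexp P G Y W.
Proof.
move=> GH [iY [_ _ E1]] [_ [mW iW E2]]; split=> //; split=> // A GA.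
by rewrite E2// E1//; exact: GH.
Qed.

(** * Quadratic forms in two variables and the past-future sigma-algebras *)

Definition qform (R : realType) (a b c d e f x y : R) : R :=
  a * x ^+ 2 + b * (x * y) + c * y ^+ 2 + d * x + e * y + f.

Lemma has_condexp_cst (d : measure_display) (T : measurableType d)
    (R : realType) (P : probability T R) (G : set_system T) (c : R) :
  has_condexp P G (fun=> c) (fun=> c).
Proof.
have ic : P.-integrable [set: T] (EFin \o (fun=> c)).
  exact: finite_measure_integrable_cst.
by apply: has_condexp_measurable.
Qed.

Lemma has_condexp_qform (d : measure_display) (T : measurableType d)
    (R : realType) (P : probability T R) (G : set_system T)
    (a b c e f g : R) (x y x' y' xx xy yy : T -> R) :
  G `<=` measurable ->
  has_condexp P G (fun w => x w ^+ 2) xx ->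
  has_condexp P G (fun w => x w * y w) xy ->
  has_condexp P G (fun w => y w ^+ 2) yy ->
  has_condexp P G x x' -> has_condexp P G y y' ->
  has_condexp P G (fun w => qform a b c e f g (x w) (y w))
    (fun w => a * xx w + b * xy w + c * yy w + e * x' w + f * y' w + g).
Proof.
move=> GT hxx hxy hyy hx hy.
by do !apply: has_condexpD => //; [exact: has_condexpZ..|exact: has_condexp_cst].
Qed.

Lemma past_future_measurable_fun (d : measure_display) (T : measurableType d)
    (R : realType) (P : probability T R) (X : R -> {RV P >-> R}) (s u r : R) :
  0 < r -> r <= s \/ u <= r ->
  measurable_fun [set: g_sigma_algebraType (past_future X s u)]
    (X r : g_sigma_algebraType (past_future X s u) -> R).
Proof.
move=> r0 rsu _ B mB; apply: sub_sigma_algebra; apply: sub_sigma_algebra.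
exists r; last by exists B.
by case: rsu => ?; [left|right]; rewrite /= in_itv/= ?r0 ?andbT.
Qed.

Lemma past_future_sub (d : measure_display) (T : measurableType d)
    (R : realType) (P : probability T R) (X : R -> {RV P >-> R})
    (s u s' u' : R) : s <= s' -> u' <= u ->
  past_future X s u `<=` past_future X s' u'.
Proof.
move=> ss' uu'; apply: smallest_sub; first exact: smallest_sigma_algebra.
move=> B [r rsu XB]; apply: sub_sigma_algebra; exists r => //.
rewrite /= !in_itv/= !andbT in rsu *.
case: rsu => [/andP[r0 rs]|ur]; [left|right].
  by rewrite r0 (le_trans rs).
exact: le_trans uu' ur.
Qed.

(** An expectation is a conditional expectation given the trivial sigma-algebra, so
    [has_condexp_qform] also computes unconditional moments. *)
Lemma has_condexp_trivial (d : measure_display) (T : measurableType d)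
    (R : realType) (P : probability T R) (Y : T -> R) (m : R) :
  P.-integrable [set: T] (EFin \o Y) -> ('E_P[Y] = m%:E)%E ->
  has_condexp P [set set0; setT] Y (fun=> m).
Proof.
move=> iY Ym; split=> //; split => //.
  exact: finite_measure_integrable_cst.
move=> A [->|->]; first by rewrite !integral_set0.
by move: Ym; rewrite unlock => ->; rewrite integral_cst//= probability_setT mule1.
Qed.

Lemma qform_ae_inj (d : measure_display) (T : measurableType d)
    (R : realType) (P : probability T R) (x y : T -> R)
    (a b c e f g a' b' c' e' f' g' : R) :
  ae_lin_indep P [tuple (fun=> 1); x; y; (fun w => x w * y w);
    (fun w => x w ^+ 2); (fun w => y w ^+ 2)] ->
  {ae P, forall w,
    qform a b c e f g (x w) (y w) = qform a' b' c' e' f' g' (x w) (y w)} ->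
  (a, b, c, e, f, g) = (a', b', c', e', f', g').
Proof.
(* Coefficient differences, in the order of the tuple: [1], [x], [y], [x * y], [x ^+ 2],
   [y ^+ 2]. *)
pose k := [:: g - g'; e - e'; f - f'; b - b'; a - a'; c - c'].
move=> /(_ (fun i => k`_i)) indep eqQ.
have {}indep i : (i < 6)%N -> k`_i = 0.
  move=> i6; apply: (indep _ (Ordinal i6)); apply: filterS eqQ => w.
  move=> /eqP; rewrite -subr_eq0 => /eqP eqw; rewrite -[RHS]eqw.
  rewrite !big_ord_recl big_ord0 !(tnth_nth (fun=> 0)) /k /= /qform; ring.
have eq i x1 y1 : (i < 6)%N -> k`_i = x1 - y1 -> x1 = y1.
  by move=> /indep -> /esym/eqP; rewrite subr_eq0 => /eqP.
by rewrite (eq 0%N g g')// (eq 1%N e e')// (eq 2%N f f')// (eq 3%N b b')//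
  (eq 4%N a a')// (eq 5%N c c').
Qed.

Lemma eq_has_condexp (d : measure_display) (T : measurableType d)
    (R : realType) (P : probability T R) (G : set_system T)
    (Y Y' Z Z' : T -> R) :
  Y =1 Y' -> Z =1 Z' -> has_condexp P G Y Z -> has_condexp P G Y' Z'.
Proof. by move=> /funext -> /funext ->. Qed.

(** * Deterministic algebra: proportionality to [F] and signs of the parameters *)

(** Relations shared by all coefficients [v] of the conditional variance: the first comes from the
    product of the values at [t] and [r], the others from conditioning through [(s, r)] and through
    [(t, u)]. *)
Definition transfers (R : realFieldType) (A C v : R -> R -> R -> R) : Prop :=
  forall s t r u : R, 0 < s -> s < t -> t < r -> r < u ->
  [/\ (u - r) * (r - s) * v t s u = (u - t) * (t - s) * v r s u,
      v t s u = v t s r + C t s r * v r s u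
    & v r s u = v r t u + A r t u * v t s u].

(** The ratio [rho] of [v] to [F] does not see [t] by the first relation. The other two are linear
    and hold for both [v] and [F], so subtracting a multiple of the one for [F] shows that moving
    [u] or [s] leaves [rho] unchanged too. *)
Lemma transfers_ratio (R : realFieldType) (A C F v : R -> R -> R -> R) :
  (forall s t u : R, 0 < s -> s < t -> t < u -> F t s u != 0) ->
  transfers A C F -> transfers A C v ->
  exists k, forall s t u : R, 0 < s -> s < t -> t < u -> v t s u = k * F t s u.
Proof.
move=> F0 trF trv; pose rho t s u := v t s u / F t s u.
have vE s t u : 0 < s -> s < t -> t < u -> v t s u = rho t s u * F t s u.
  by move=> s0 st tu; rewrite /rho divfK// F0.
have rho_mid s t r u : 0 < s -> s < t -> t < r -> r < u ->
    rho t s u = rho r s u.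
  move=> s0 st tr ru; have sr := lt_trans st tr; have tu := lt_trans tr ru.
  have [eF _ _] := trF _ _ _ _ s0 st tr ru.
  have [ev _ _] := trv _ _ _ _ s0 st tr ru.
  have nz : (u - r) * (r - s) != 0 by rewrite mulf_neq0 ?subr_eq0 ?gt_eqF.
  move: (F0 _ _ _ s0 sr ru) (F0 _ _ _ s0 st tu) => Fr Ft.
  apply/eqP; rewrite /rho eqr_div//; apply/eqP/(mulfI nz).
  by rewrite mulrA ev mulrCA eF; ring.
have rho_right s t r u : 0 < s -> s < t -> t < r -> r < u ->
    rho t s u = rho t s r.
  move=> s0 st tr ru; have sr := lt_trans st tr; have tu := lt_trans tr ru.
  have [_ eF _] := trF _ _ _ _ s0 st tr ru.
  have [_ ev _] := trv _ _ _ _ s0 st tr ru.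
  apply: (mulIf (F0 _ _ _ s0 st tr)); rewrite -vE//.
  move: ev; rewrite (vE s t u)// (vE s r u)// -(rho_mid s t r u)// eF => ev.
  by apply/eqP; rewrite -subr_eq0; apply/eqP; lra.
have rho_left s t r u : 0 < s -> s < t -> t < r -> r < u ->
    rho r s u = rho r t u.
  move=> s0 st tr ru; have sr := lt_trans st tr; have tu := lt_trans tr ru.
  have t0 := lt_trans s0 st.
  have [_ _ eF] := trF _ _ _ _ s0 st tr ru.
  have [_ _ ev] := trv _ _ _ _ s0 st tr ru.
  apply: (mulIf (F0 _ _ _ t0 tr ru)); rewrite -vE//.
  move: ev; rewrite (vE s t u)// (vE s r u)// (rho_mid s t r u)// eF => ev.
  by apply/eqP; rewrite -subr_eq0; apply/eqP; lra.
have rho_eq s t u t' : 0 < s -> s < t -> t < u -> s < t' -> t' < u ->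
    rho t s u = rho t' s u.
  move=> s0 st tu st' t'u; have [tt'|t't|->//] := ltgtP t t'.
    exact: rho_mid.
  by apply/esym; exact: rho_mid.
(* Any intermediate time would do; the midpoint makes [rho] a function [rh] of the endpoints
   alone. *)
pose mid (x y : R) := (x + y) / 2.
have mids (x y : R) : x < y -> x < mid x y /\ mid x y < y.
  by rewrite /mid => xy; split; lra.
pose rh s u := rho (mid s u) s u.
have rhE s t u : 0 < s -> s < t -> t < u -> rho t s u = rh s u.
  move=> s0 st tu; have [m1 m2] := mids s u (lt_trans st tu).
  exact: rho_eq.
have rh_right s r u : 0 < s -> s < r -> r < u -> rh s u = rh s r.
  move=> s0 sr ru; have [m1 m2] := mids s r sr.
  by rewrite -(rhE s (mid s r) u) ?(lt_trans m2)// (rho_right s (mid s r) r u).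
have rh_left s t u : 0 < s -> s < t -> t < u -> rh s u = rh t u.
  move=> s0 st tu; have [m1 m2] := mids t u tu.
  by rewrite -(rhE s (mid t u) u) ?(lt_trans _ m1)// (rho_left s t (mid t u) u).
exists (rh 1 2) => s t u s0 st tu; rewrite vE// rhE//; congr (_ * _).
have u0 := lt_trans s0 (lt_trans st tu).
(* The right end [u + 3] exceeds both [u] and [2], so both pairs can be moved to it before the left
   ends [s] and [1] are compared. *)
rewrite -(rh_right s u (u + 3)) ?(lt_trans st)//; last by lra.
rewrite -(rh_right 1 2 (u + 3)) ?ltr1n//; last by lra.
have [s1|s1|->//] := ltgtP s 1.
  by rewrite (rh_left s 1 (u + 3)) //; lra.
by rewrite (rh_left 1 s (u + 3)) // ; lra.
Qed.

(* [D(s, u) = u (1 + sigma s) + tau - q s] is affine in each variable: if it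
   never vanishes on [0 < s < u], it has the sign of its values for [s] near 0
   and [u] large. *)
Lemma denominator_gt0 (R : realFieldType) (sigma tau q : R) :
  (forall s u : R, 0 < s -> s < u -> u * (1 + sigma * s) + tau - q * s != 0) ->
  forall s u : R, 0 < s -> s < u -> 0 < u * (1 + sigma * s) + tau - q * s.
Proof.
move=> nz s u s0 su; rewrite lt_neqAle eq_sym nz//= leNgt; apply/negP => neg.
have u0 := lt_trans s0 su.
have neg_u w : s < w -> w * (1 + sigma * s) + tau - q * s < 0.
  move=> sw; rewrite lt_neqAle nz//= leNgt; apply/negP => pos.
  pose Du := u * (1 + sigma * s) + tau - q * s.
  pose Dw := w * (1 + sigma * s) + tau - q * s.
  have DD : 0 < Dw - Du by rewrite subr_gt0 (lt_trans neg).
  (* The zero of the affine function through [(u, Du)] and [(w, Dw)]. As [Du < 0 < Dw], it is a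
     convex combination of [u] and [w], hence beyond [s]. *)
  pose r := (u * Dw - w * Du) / (Dw - Du).
  have sr : s < r.
    rewrite /r ltr_pdivlMr// -subr_gt0.
    have -> : u * Dw - w * Du - s * (Dw - Du) = (u - s) * Dw + (w - s) * - Du.
      by ring.
    have us : 0 < u - s by rewrite subr_gt0.
    have ws : 0 < w - s by rewrite subr_gt0.
    have Du0 : 0 < - Du by rewrite oppr_gt0.
    by rewrite (addr_gt0 (mulr_gt0 us pos) (mulr_gt0 ws Du0)).
  move: (nz s r s0 sr); rewrite (_ : _ + _ - _ = 0) ?eqxx//.
  by rewrite /r /Dw /Du; field; move: DD; rewrite /Dw /Du => /lt0r_neq0.
(* Large enough for [s < w] and for [w + tau], the value of the denominator at first variable zero,
   to be positive. *)
pose w := s + u + `|tau| + 1.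
have sw : s < w by rewrite /w; have := normr_ge0 tau; lra.
have pos0 : 0 < w + tau.
  rewrite /w; have := lerNnormlW (lexx `|tau|); lra.
pose Dw := w * (1 + sigma * s) + tau - q * s.
have DD : 0 < w + tau - Dw by rewrite subr_gt0 (lt_trans (neg_u w sw)).
(* The zero in the first variable, between [0] (value [w + tau > 0]) and [s] (value [Dw < 0]). *)
pose r := s * (w + tau) / (w + tau - Dw).
have r0 : 0 < r by rewrite /r divr_gt0// mulr_gt0.
have rs : r < s.
  by rewrite /r ltr_pdivrMr// ltr_pM2l// ltrDl oppr_gt0 neg_u.
move: (nz r w r0 (lt_trans rs sw)); rewrite (_ : _ + _ - _ = 0) ?eqxx//.
by rewrite /r /Dw; field; move: DD; rewrite /Dw => /lt0r_neq0.
Qed.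

(** In place of a limit at zero: if [c < 0], then [s = - c / k] is at most [1], so the polynomial is
    at most [(|a| + |b|) * s + c = - s * (1 - c) < 0]. *)
Lemma quadratic_ge0_cst (R : realFieldType) (a b c : R) :
  (forall s, 0 < s -> 0 <= a * s ^+ 2 + b * s + c) -> 0 <= c.
Proof.
move=> h; rewrite leNgt; apply/negP => c0.
pose k := `|a| + `|b| + 1 - c.
have k0 : 0 < k by rewrite /k; have := normr_ge0 a; have := normr_ge0 b; lra.
pose s := - c / k.
have s0 : 0 < s by rewrite /s divr_gt0// oppr_gt0.
have sk : s * k = - c by rewrite /s divfK// gt_eqF.
have s1 : s <= 1.
  rewrite /s ler_pdivrMr// mul1r /k.
  by have := normr_ge0 a; have := normr_ge0 b; lra.
have as2 : a * s ^+ 2 <= `|a| * s.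
  have : a * s ^+ 2 <= `|a| * s ^+ 2 by rewrite ler_wpM2r ?ler_norm ?exprn_ge0// ltW.
  have : `|a| * s ^+ 2 <= `|a| * s.
    by rewrite ler_wpM2l// expr2 -[leRHS]mulr1 ler_wpM2l// ltW.
  lra.
have bs : b * s <= `|b| * s by rewrite ler_wpM2r ?ler_norm// ltW.
have := h s s0; have : 0 < s * (1 - c) by rewrite mulr_gt0//; lra.
by move: sk; rewrite /k; lra.
Qed.

(** Inverting [s] exchanges [a] and [c]. If both are nonzero, evaluation at the square root of
    [c / a] bounds [b]; if one vanishes, dividing out leaves an affine function with an endpoint
    coefficient [b]. *)
Lemma quadratic_ge0_coefs (R : rcfType) (a b c : R) :
  (forall s, 0 < s -> 0 <= a * s ^+ 2 + b * s + c) ->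
  [/\ 0 <= a, 0 <= c & - b <= 2 * Num.sqrt (a * c)].
Proof.
move=> h; have c0 := quadratic_ge0_cst h.
have h' s : 0 < s -> 0 <= c * s ^+ 2 + b * s + a.
  move=> s0; have sV0 : 0 < s^-1 by rewrite invr_gt0.
  have : 0 <= s ^+ 2 * (a * s^-1 ^+ 2 + b * s^-1 + c).
    by rewrite mulr_ge0 ?h// exprn_ge0// ltW.
  by congr (0 <= _); field; rewrite gt_eqF.
have a0 := quadratic_ge0_cst h'; split=> //.
have [az|an] := eqVneq a 0.
  rewrite az mul0r sqrtr0 mulr0 oppr_le0.
  apply: (@quadratic_ge0_cst _ 0 c) => s s0; rewrite mul0r add0r.
  by have := h' s s0; rewrite az addr0 expr2 mulrA -mulrDl pmulr_lge0.
have [cz|cn] := eqVneq c 0.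
  rewrite cz mulr0 sqrtr0 mulr0 oppr_le0.
  apply: (@quadratic_ge0_cst _ 0 a) => s s0; rewrite mul0r add0r.
  by have := h s s0; rewrite cz addr0 expr2 mulrA -mulrDl pmulr_lge0.
rewrite sqrtrM//; set x := Num.sqrt a; set y := Num.sqrt c.
have x0 : 0 < x by rewrite sqrtr_gt0 lt_neqAle eq_sym an.
have y0 : 0 < y by rewrite sqrtr_gt0 lt_neqAle eq_sym cn.
have yx0 : 0 < y / x by rewrite divr_gt0.
have := h _ yx0; rewrite -(sqr_sqrtr a0) -(sqr_sqrtr c0) -/x -/y.
have -> : x ^+ 2 * (y / x) ^+ 2 + b * (y / x) + y ^+ 2 =
    (2 * (x * y) + b) * (y / x) by field; rewrite gt_eqF.
by rewrite pmulr_lge0//; lra.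
Qed.

(** As [u] decreases to [s], the denominator tends to [sigma * s ^+ 2 + (1 - q) * s + tau], which is
    therefore nonnegative. *)
Lemma denominator_coefs (R : rcfType) (sigma tau q : R) :
  (forall s u : R, 0 < s -> s < u -> 0 < u * (1 + sigma * s) + tau - q * s) ->
  [/\ 0 <= sigma, 0 <= tau & q <= 1 + 2 * Num.sqrt (sigma * tau)].
Proof.
move=> pos.
suff /quadratic_ge0_coefs[s0 t0 h] :
    forall s, 0 < s -> 0 <= sigma * s ^+ 2 + (1 - q) * s + tau.
  by split=> //; lra.
move=> s s0; rewrite leNgt; apply/negP.
set y := _ + tau => neg.
pose k := `|1 + sigma * s|; have k0 : 0 <= k := normr_ge0 _.
(* At [u = s + e] the denominator is [y + e * (1 + sigma * s)], at most [y + e * k = - e < 0]. *)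
pose e := - y / (1 + k).
have e0 : 0 < e by rewrite /e divr_gt0//; lra.
have ek : e * (1 + k) = - y by rewrite /e divfK// gt_eqF//; lra.
have : e * (1 + sigma * s) <= e * k by rewrite ler_wpM2l ?ler_norm// ltW.
have : s < s + e by lra.
by move=> /(pos _ _ s0); move: neg ek; rewrite /y; lra.
Qed.

(** * Identities between the coefficients of a quadratic harness *)

Section quadratic_harness_coefficients.
Context (d : measure_display) (T : measurableType d) (R : realType).
Context (P : probability T R) (X : R -> {RV P >-> R}).
Context (A B C D E F : R -> R -> R -> R).
Context (X_L2 : forall t : R, 0 < t -> (X t : T -> R) \in Lfun P 2%:E).
Context (X_harness : quadratic_harness X A B C D E F).
Context (X_indep : forall s t : R, 0 < s -> s < t ->
       ae_lin_indep P [tuple (fun=> 1); (X s : T -> R); (X t : T -> R);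
         (fun w => X s w * X t w); (fun w => X s w ^+ 2);
         (fun w => X t w ^+ 2)]).

Notation integrable Y := (P.-integrable [set: T] (EFin \o Y)).
Notation Q t s u :=
  (qform (A t s u) (B t s u) (C t s u) (D t s u) (E t s u) (F t s u)).
Notation L t s u x y := ((u - t) / (u - s) * x + (t - s) / (u - s) * y).

Lemma integrable_process t : 0 < t -> integrable (X t).
Proof.
by move=> t0; apply/Lfun1_integrable/Lfun_subset12; rewrite ?fin_num_measure ?X_L2.
Qed.

Lemma integrable_processM s t : 0 < s -> 0 < t ->
  integrable (fun w => X s w * X t w).
Proof. by move=> s0 t0; apply/Lfun1_integrable/Lfun2_mul_Lfun1; exact: X_L2. Qed.

Lemma integrable_process_sqr t : 0 < t -> integrable (fun w => X t w ^+ 2).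
Proof. by move=> t0; apply/Lfun2_integrable_sqr/X_L2. Qed.

Lemma integrable_lin (a b s t : R) : 0 < s -> 0 < t ->
  integrable (fun w => a * X s w + b * X t w).
Proof.
move=> s0 t0.
have is_ := integrableZl measurableT a (integrable_process s0).
have it := integrableZl measurableT b (integrable_process t0).
exact: (integrableD measurableT is_ it).
Qed.

Lemma integrable_qform (a b c e f g s t : R) : 0 < s -> 0 < t ->
  integrable (fun w => qform a b c e f g (X s w) (X t w)).
Proof.
move=> s0 t0.
have is_ := integrable_process s0; have it := integrable_process t0.
have iss := integrable_process_sqr s0; have itt := integrable_process_sqr t0.
have ist := integrable_processM s0 t0.
have Z k (f0 : T -> R) : integrable f0 -> integrable (fun w => k * f0 w).
  by move=> if0; exact: (integrableZl measurableT k if0).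
have DD (f1 f2 : T -> R) : integrable f1 -> integrable f2 ->
    integrable (fun w => f1 w + f2 w).
  by move=> if1 if2; exact: (integrableD measurableT if1 if2).
have ic : integrable (fun=> g) by exact: finite_measure_integrable_cst.
exact: (DD _ _ (DD _ _ (DD _ _ (DD _ _ (DD _ _ (Z a _ iss) (Z b _ ist))
  (Z c _ itt)) (Z e _ is_)) (Z f _ it)) ic).
Qed.

Lemma has_condexp_process s t u : 0 < s -> s < t -> t < u ->
  has_condexp P (past_future X s u) (X t) (fun w => L t s u (X s w) (X u w)).
Proof.
move=> s0 st tu; have t0 := lt_trans s0 st; have u0 := lt_trans t0 tu.
have [hX _] := X_harness s0 st tu.
apply: has_condexp_ae hX.
- exact: past_future_sigma_algebra.
- exact: past_future_measurable.
- exact: integrable_process.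
- exact: integrable_lin.
- by apply: measurable_funD; apply: measurable_funM => //;
    apply: past_future_measurable_fun => //; [left|right].
Qed.

Lemma has_condexp_process_sqr s t u : 0 < s -> s < t -> t < u ->
  has_condexp P (past_future X s u) (fun w => X t w ^+ 2)
    (fun w => Q t s u (X s w) (X u w)).
Proof.
move=> s0 st tu; have t0 := lt_trans s0 st; have u0 := lt_trans t0 tu.
have [_ hX] := X_harness s0 st tu.
apply: has_condexp_ae hX.
- exact: past_future_sigma_algebra.
- exact: past_future_measurable.
- exact: integrable_process_sqr.
- exact: integrable_qform.
- have mXs : measurable_fun [set: g_sigma_algebraType (past_future X s u)]
      (X s : g_sigma_algebraType (past_future X s u) -> R).
    by apply: past_future_measurable_fun => //; left.
  have mXu : measurable_fun [set: g_sigma_algebraType (past_future X s u)]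
      (X u : g_sigma_algebraType (past_future X s u) -> R).
    by apply: past_future_measurable_fun => //; right.
  by do !apply: measurable_funD => //; apply: measurable_funM => //;
    try exact: measurable_funX; exact: measurable_funM.
Qed.

(** Outer step of each tower argument: the value at the endpoint [r] is known and factors out, and
    the harness conditions handle [X t] and its square. *)
Lemma has_condexp_process_qform (a b c e f g s t u r : R) :
  0 < s -> s < t -> t < u -> r = s \/ r = u ->
  has_condexp P (past_future X s u)
    (fun w => qform a b c e f g (X r w) (X t w))
    (fun w => a * X r w ^+ 2 + b * (X r w * L t s u (X s w) (X u w)) +
      c * Q t s u (X s w) (X u w) + e * X r w +
      f * L t s u (X s w) (X u w) + g).
Proof.
move=> s0 st tu rsu; have t0 := lt_trans s0 st; have u0 := lt_trans t0 tu.
have r0 : 0 < r by case: rsu => ->.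
have mXr : measurable_fun [set: g_sigma_algebraType (past_future X s u)]
    (X r : g_sigma_algebraType (past_future X s u) -> R).
  by apply: past_future_measurable_fun => //; case: rsu => ->; [left|right].
have PFT := @past_future_measurable _ _ _ P X s u.
apply: has_condexp_qform => //.
- apply: has_condexp_measurable; first exact: measurable_funX.
  exact: integrable_process_sqr.
- apply: has_condexpM => //.
  + exact: past_future_sigma_algebra.
  + exact: integrable_processM.
  + case: rsu => ->.
      have := integrable_qform ((u - t) / (u - s)) ((t - s) / (u - s)) 0 0 0 0
        s0 u0.
      by apply: eq_integrable => // w _ /=; congr EFin; rewrite /qform; ring.
    have := integrable_qform 0 ((u - t) / (u - s)) ((t - s) / (u - s)) 0 0 0
      s0 u0.
    by apply: eq_integrable => // w _ /=; congr EFin; rewrite /qform; ring.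
  + exact: has_condexp_process.
- exact: has_condexp_process_sqr.
- by apply: has_condexp_measurable => //; exact: integrable_process.
- exact: has_condexp_process.
Qed.

Lemma coef_condexp_past s t r u : 0 < s -> s < t -> t < r -> r < u ->
  (A t s u, B t s u, C t s u, D t s u, E t s u, F t s u) =
  (A t s r + B t s r * ((u - r) / (u - s)) + C t s r * A r s u,
   B t s r * ((r - s) / (u - s)) + C t s r * B r s u,
   C t s r * C r s u,
   D t s r + E t s r * ((u - r) / (u - s)) + C t s r * D r s u,
   E t s r * ((r - s) / (u - s)) + C t s r * E r s u,
   F t s r + C t s r * F r s u).
Proof.
move=> s0 st tr ru; have sr := lt_trans st tr; have tu := lt_trans tr ru.
apply: (qform_ae_inj (X_indep s0 (lt_trans st tu))).
have := has_condexp_unique (past_future_sigma_algebra _ _ _)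
  (@past_future_measurable _ _ _ P X s u)
  (has_condexp_process_sqr s0 st tu)
  (has_condexp_tower (past_future_sub (lexx s) (ltW ru))
    (has_condexp_process_sqr s0 st tr)
    (has_condexp_process_qform _ _ _ _ _ _ s0 sr ru
      (or_introl erefl))).
by apply: filterS => w ->; rewrite /qform; ring.
Qed.

Lemma coef_condexp_future s t r u : 0 < s -> s < t -> t < r -> r < u ->
  (A r s u, B r s u, C r s u, D r s u, E r s u, F r s u) =
  (A r t u * A t s u,
   B r t u * ((u - t) / (u - s)) + A r t u * B t s u,
   C r t u + B r t u * ((t - s) / (u - s)) + A r t u * C t s u,
   D r t u * ((u - t) / (u - s)) + A r t u * D t s u,
   E r t u + D r t u * ((t - s) / (u - s)) + A r t u * E t s u,
   F r t u + A r t u * F t s u).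
Proof.
move=> s0 st tr ru; have sr := lt_trans st tr; have tu := lt_trans tr ru.
have t0 := lt_trans s0 st.
apply: (qform_ae_inj (X_indep s0 (lt_trans st tu))).
(* The variables are exchanged so that the known endpoint value [X u] comes first, as
   [has_condexp_process_qform] requires. *)
have cond : has_condexp P (past_future X t u) (fun w => X r w ^+ 2)
    (fun w => qform (C r t u) (B r t u) (A r t u) (E r t u) (D r t u) (F r t u)
      (X u w) (X t w)).
  apply: eq_has_condexp (has_condexp_process_sqr t0 tr ru) => //.
  by move=> w; rewrite /qform; ring.
have := has_condexp_unique (past_future_sigma_algebra _ _ _)
  (@past_future_measurable _ _ _ P X s u)
  (has_condexp_process_sqr s0 sr ru)
  (has_condexp_tower (past_future_sub (ltW st) (lexx u)) cond
    (has_condexp_process_qform _ _ _ _ _ _ s0 st tu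
      (or_intror erefl))).
by apply: filterS => w ->; rewrite /qform; ring.
Qed.

(** [X t] factors out given [past_future X t u], and [X r] given [past_future X s r]. Here [p], [p']
    are the weights of [X t], [X u] in the conditional mean of [X r], and [q], [q'] those of [X r],
    [X s] in that of [X t]. *)
Lemma coef_condexp_prod s t r u : 0 < s -> s < t -> t < r -> r < u ->
  let p := (u - r) / (u - t) in let p' := (r - t) / (u - t) in
  let q := (t - s) / (r - s) in let q' := (r - t) / (r - s) in
  (p * A t s u, p * B t s u + p' * ((u - t) / (u - s)),
   p * C t s u + p' * ((t - s) / (u - s)),
   p * D t s u, p * E t s u, p * F t s u) =
  (q * A r s u + q' * ((u - r) / (u - s)),
   q * B r s u + q' * ((r - s) / (u - s)),
   q * C r s u, q * D r s u, q * E r s u, q * F r s u).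
Proof.
move=> s0 st tr ru p p' q q'.
have sr := lt_trans st tr; have tu := lt_trans tr ru.
have t0 := lt_trans s0 st; have r0 := lt_trans t0 tr.
have u0 := lt_trans t0 tu.
apply: (qform_ae_inj (X_indep s0 (lt_trans st tu))).
have condt : has_condexp P (past_future X t u) (fun w => X t w * X r w)
    (fun w => qform 0 p' p 0 0 0 (X u w) (X t w)).
  apply: eq_has_condexp (has_condexpM (past_future_sigma_algebra _ _ _)
    (@past_future_measurable _ _ _ P X t u) _ _ _
    (has_condexp_process t0 tr ru)) => //.
  - by move=> w; rewrite /qform /p /p'; ring.
  - by apply: past_future_measurable_fun => //; left.
  - exact: integrable_processM.
  - have := integrable_qform 0 p' p 0 0 0 u0 t0.
    apply: eq_integrable => // w _ /=; congr EFin.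
    by rewrite /qform /p /p'; ring.
have condr : has_condexp P (past_future X s r) (fun w => X t w * X r w)
    (fun w => qform 0 q' q 0 0 0 (X s w) (X r w)).
  apply: eq_has_condexp (has_condexpM (past_future_sigma_algebra _ _ _)
    (@past_future_measurable _ _ _ P X s r) _ _ _
    (has_condexp_process s0 st tr)) => //.
  - by move=> w; rewrite mulrC.
  - by move=> w; rewrite /qform /q /q'; ring.
  - by apply: past_future_measurable_fun => //; right.
  - exact: integrable_processM.
  - have := integrable_qform 0 q' q 0 0 0 s0 r0.
    apply: eq_integrable => // w _ /=; congr EFin.
    by rewrite /qform /q /q'; ring.
have := has_condexp_unique (past_future_sigma_algebra _ _ _)
  (@past_future_measurable _ _ _ P X s u)
  (has_condexp_tower (past_future_sub (ltW st) (lexx u)) condt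
    (has_condexp_process_qform _ _ _ _ _ _ s0 st tu
      (or_intror erefl)))
  (has_condexp_tower (past_future_sub (lexx s) (ltW ru)) condr
    (has_condexp_process_qform _ _ _ _ _ _ s0 sr ru
      (or_introl erefl))).
move: p p' q q' {condt condr} => p p' q q'.
by apply: filterS => w eqw; apply: etrans (etrans eqw _); rewrite /qform; ring.
Qed.

Lemma coef_expectation s t u : 0 < s -> s < t -> t < u ->
  (forall t : R, 0 < t -> ('E_P[X t] = 0)%E) ->
  (forall s t : R, 0 < s -> 0 < t ->
    ('E_P[(fun w => X t w * X s w)%R] = (Num.min t s)%:E)%E) ->
  A t s u * s + B t s u * s + C t s u * u + F t s u = t.
Proof.
move=> s0 st tu Xm Xc; have t0 := lt_trans s0 st; have u0 := lt_trans t0 tu.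
have sqr r : 0 < r ->
    has_condexp P [set set0; setT] (fun w => X r w ^+ 2) (fun=> r).
  move=> r0; apply: has_condexp_trivial; first exact: integrable_process_sqr.
  by under eq_fun do rewrite expr2; rewrite Xc// minxx.
have mean r : 0 < r -> has_condexp P [set set0; setT] (X r) (fun=> 0).
  move=> r0; apply: has_condexp_trivial; first exact: integrable_process.
  exact: Xm.
have prod : has_condexp P [set set0; setT] (fun w => X s w * X u w) (fun=> s).
  apply: has_condexp_trivial; first exact: integrable_processM.
  by rewrite Xc// min_l// ltW// (lt_trans st).
have GT : [set set0; [set: T]] `<=` measurable by move=> S [] ->.
have := has_condexp_qform (A t s u) (B t s u) (C t s u) (D t s u) (E t s u)
  (F t s u) GT (sqr s s0) prod (sqr u u0) (mean s s0) (mean u u0).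
move=> [_ [_ _ /(_ setT (or_intror erefl))]].
rewrite -(has_condexp_expectation (past_future_sigma_algebra _ _ _)
  (has_condexp_process_sqr s0 st tu)).
have [_ [_ _ /(_ setT (or_intror erefl)) <-]] := sqr t t0.
rewrite !integral_cst//= probability_setT !mule1 => -[eqt]; rewrite -[RHS]eqt; ring.
Qed.

(* In the variables [p = tDelta] and [m = Delta], i.e. [x = p + s m] and
   [y = p + u m], the conditional mean is [p + t m]; these are the coefficients
   of the conditional variance at [p], [m], [p ^+ 2], [m ^+ 2] and [p * m]. *)
Lemma condvar_coefs_transfer :
  [/\ transfers A C F,
      transfers A C (fun t s u => D t s u + E t s u)
    & transfers A C (fun t s u => s * D t s u + u * E t s u)] /\
  [/\ transfers A C (fun t s u => A t s u + B t s u + C t s u - 1),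
      transfers A C (fun t s u =>
        s ^+ 2 * A t s u + s * u * B t s u + u ^+ 2 * C t s u - t ^+ 2)
    & transfers A C (fun t s u =>
        2 * s * A t s u + (s + u) * B t s u + 2 * u * C t s u - 2 * t)].
Proof.
split; split=> s t r u s0 st tr ru;
  have [A1 B1 C1 D1 E1 F1] := coef_condexp_past s0 st tr ru;
  have [A2 B2 C2 D2 E2 F2] :=
    coef_condexp_future s0 st tr ru;
  have /= [A3 B3 C3 D3 E3 F3] :=
    coef_condexp_prod s0 st tr ru;
  have su0 : u - s != 0 by [rewrite subr_eq0 gt_eqF// (lt_trans st)// (lt_trans tr)];
  have tu0 : u - t != 0 by [rewrite subr_eq0 gt_eqF// (lt_trans tr)];
  have sr0 : r - s != 0 by [rewrite subr_eq0 gt_eqF// (lt_trans st)];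
  have ru0 : u - r != 0 by [rewrite subr_eq0 gt_eqF];
  (* [solve] and [solveD] express each coefficient at [t] through those at [r], so that rewriting
     leaves rational identities for [field]. *)
  have solve a z : (u - r) / (u - t) * a = z -> a = (u - t) / (u - r) * z
    by [move=> <-; field; rewrite tu0 ru0];
  have solveD a k z : (u - r) / (u - t) * a + k = z ->
      a = (u - t) / (u - r) * (z - k)
    by [move=> <-; field; rewrite tu0 ru0];
  move: A3 B3 C3 D3 E3 F3 =>
    /solve A3 /solveD B3 /solveD C3 /solve D3 /solve E3 /solve F3.
- by split=> //; rewrite F3; field; rewrite ?su0 ?tu0 ?sr0 ?ru0.
- split; first by rewrite D3 E3; field; rewrite ?su0 ?tu0 ?sr0 ?ru0.
    by rewrite D1 E1; field; rewrite ?su0 ?tu0 ?sr0 ?ru0.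
  by rewrite D2 E2; field; rewrite ?su0 ?tu0 ?sr0 ?ru0.
- split; first by rewrite D3 E3; field; rewrite ?su0 ?tu0 ?sr0 ?ru0.
    by rewrite D1 E1; field; rewrite ?su0 ?tu0 ?sr0 ?ru0.
  by rewrite D2 E2; field; rewrite ?su0 ?tu0 ?sr0 ?ru0.
- split; first by rewrite A3 B3 C3; field; rewrite ?su0 ?tu0 ?sr0 ?ru0.
    by rewrite A1 B1 C1; field; rewrite ?su0 ?tu0 ?sr0 ?ru0.
  by rewrite A2 B2 C2; field; rewrite ?su0 ?tu0 ?sr0 ?ru0.
- split; first by rewrite A3 B3 C3; field; rewrite ?su0 ?tu0 ?sr0 ?ru0.
    by rewrite A1 B1 C1; field; rewrite ?su0 ?tu0 ?sr0 ?ru0.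
  by rewrite A2 B2 C2; field; rewrite ?su0 ?tu0 ?sr0 ?ru0.
- split; first by rewrite A3 B3 C3; field; rewrite ?su0 ?tu0 ?sr0 ?ru0.
    by rewrite A1 B1 C1; field; rewrite ?su0 ?tu0 ?sr0 ?ru0.
  by rewrite A2 B2 C2; field; rewrite ?su0 ?tu0 ?sr0 ?ru0.
Qed.

End quadratic_harness_coefficients.

(** * Identification of the parameters and computation of [F] *)

Theorem theorem2p2 (d : measure_display) (T : measurableType d)
    (R : realType) (P : probability T R) (X : R -> {RV P >-> R})
    (A B C D E F : R -> R -> R -> R)
    (X_separable : separable_process X)
    (X_L2 : forall t : R, 0 < t -> (X t : T -> R) \in Lfun P 2%:E)
    (X_harness : quadratic_harness X A B C D E F)
    (X_mean : forall t : R, 0 < t -> ('E_P[X t] = 0)%E)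
    (X_cov : forall s t : R, 0 < s -> 0 < t ->
       ('E_P[(fun w => X t w * X s w)%R] = (Num.min t s)%:E)%E)
    (F_neq0 : forall s t u : R, 0 < s -> s < t -> t < u -> F t s u != 0)
    (X_indep : forall s t : R, 0 < s -> s < t ->
       ae_lin_indep P [tuple (fun=> 1); (X s : T -> R); (X t : T -> R);
         (fun w => X s w * X t w); (fun w => X s w ^+ 2);
         (fun w => X t w ^+ 2)]) :
  exists eta theta sigma tau q : R,
    [/\ 0 <= sigma, 0 <= tau, q <= 1 + 2 * Num.sqrt (sigma * tau)
      & forall s t u : R, 0 < s -> s < t -> t < u ->
          F t s u = (u - t) * (t - s) / (u * (1 + sigma * s) + tau - q * s) /\
          {ae P, forall w, condvar P (past_future X s u) (X t) w =
             F t s u * (1 + eta * tDelta X s u w + theta * Delta X s u w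
               + sigma * tDelta X s u w ^+ 2 + tau * Delta X s u w ^+ 2
               - (1 - q) * (Delta X s u w * tDelta X s u w))}].
Proof.
have [[trF treta trtheta] [trsigma trtau trrho]] :=
  condvar_coefs_transfer X_L2 X_harness X_indep.
have [eta etaE] := transfers_ratio F_neq0 trF treta.
have [theta thetaE] := transfers_ratio F_neq0 trF trtheta.
have [sigma sigmaE] := transfers_ratio F_neq0 trF trsigma.
have [tau tauE] := transfers_ratio F_neq0 trF trtau.
have [rho rhoE] := transfers_ratio F_neq0 trF trrho.
pose q := 1 + rho.
have FE s t u : 0 < s -> s < t -> t < u ->
    F t s u * (u * (1 + sigma * s) + tau - q * s) = (u - t) * (t - s).
  move=> s0 st tu; have := coef_expectation X_L2 X_harness s0 st tu X_mean X_cov.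
  move: (sigmaE s t u s0 st tu) (tauE s t u s0 st tu) (rhoE s t u s0 st tu).
  move=> hs ht hr he.
  (* The weights [u * s], [1], [- s], [u - s] are [u - s] times the expectations of [tDelta ^+ 2],
     [Delta ^+ 2], [Delta * tDelta] and [1]; the linear terms have mean zero. *)
  rewrite (_ : F t s u * _ = u * s * (sigma * F t s u) + tau * F t s u
    - s * (rho * F t s u) + (u - s) * F t s u); last by rewrite /q; ring.
  rewrite -hs -ht -hr.
  rewrite (_ : _ + _ = (u - s) * (A t s u * s + B t s u * s + C t s u * u
    + F t s u) - u * s - t ^+ 2 + 2 * t * s); last by ring.
  by rewrite he; ring.
have den0 s u : 0 < s -> s < u -> u * (1 + sigma * s) + tau - q * s != 0.
  move=> s0 su; apply/eqP => den0.
  (* A zero of the denominator would make [FE] fail at the midpoint, where its right-hand side is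
     nonzero. *)
  have [st tu] : s < (s + u) / 2 /\ (s + u) / 2 < u by split; lra.
  have := FE _ _ _ s0 st tu; rewrite den0 mulr0 => /esym/eqP.
  by rewrite mulf_eq0 !subr_eq0 !gt_eqF.
have [sigma0 tau0 q_le] := denominator_coefs (denominator_gt0 den0).
exists eta, theta, sigma, tau, q; split=> // s t u s0 st tu.
have su := lt_trans st tu; split.
  by rewrite -(FE s t u s0 st tu) mulfK// den0.
have [mean_eq sqr_eq] := X_harness s t u s0 st tu.
move: mean_eq sqr_eq; apply: filterS2 => w mean_eq sqr_eq.
rewrite /condvar mean_eq sqr_eq.
set p := tDelta X s u w; set m := Delta X s u w.
have us0 : u - s != 0 by rewrite subr_eq0 gt_eqF.
have -> : X s w = p + s * m by rewrite /p /m /tDelta /Delta; field.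
have -> : X u w = p + u * m by rewrite /p /m /tDelta /Delta; field.
have -> : (u - t) / (u - s) * (p + s * m) + (t - s) / (u - s) * (p + u * m) =
  p + t * m by field.
(* Grouping each parameter with [F t s u] lets the proportionalities restore the original
   coefficients, which leaves a polynomial identity in [p] and [m]. *)
transitivity (F t s u + (eta * F t s u) * p + (theta * F t s u) * m
  + (sigma * F t s u) * p ^+ 2 + (tau * F t s u) * m ^+ 2
  + (rho * F t s u) * (m * p)); last by rewrite /q; ring.
by rewrite -etaE// -thetaE// -sigmaE// -tauE// -rhoE//; ring.
Qed.
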